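(* Let $k$ be a field of characteristic zero. Let $H: 1, h_1, h_2, \ldots, h_e, h_{e+1}=0$ (with $h_i = 0$ for all $i > e$) be a sequence that occurs as the Hilbert function of some standard graded artinian $k$-algebra (equivalently, satisfies the condition of Macaulay's theorem), and let $t$ be the smallest integer such that $h_t \leq t$ (where $h_0=1$, so $t\ge 1$). Then all standard graded artinian $k$-algebras having Hilbert function $H$ enjoy the Weak Lefschetz Property if and only if, for all $i = 1, 2, \ldots, t-1$, $$h_{i-1} = ((h_i)_{(i)})^{-1}_{-1}.$$
   Context: A standard graded artinian $k$-algebra is a quotient $A = R/I$ of finite $k$-dimension, where $R = k[x_1,\ldots,x_r]$ is a polynomial ring (for some $r$) with all $x_i$ of degree 1, and $I$ is a homogeneous ideal. Its Hilbert function is $h_i = \dim_k A_i$. $A$ enjoys the Weak Lefschetz Property (WLP) if, for a generic linear form $L \in R$ (i.e. for all $L$ in some nonempty Zariski-open subset of $R_1$) and for all indices $i \geq 0$, the multiplication map $\cdot L : A_i \to A_{i+1}$ has maximal rank, i.e. is injective or surjective. For positive integers $n$ and $i$, the $i$-binomial expansion of $n$ is the unique expression $$n_{(i)} = \binom{n_i}{i} + \binom{n_{i-1}}{i-1} + \cdots + \binom{n_j}{j}, \qquad n_i > n_{i-1} > \cdots > n_j \geq j \geq 1,$$ equal to $n$. One defines $$(n_{(i)})^{-1}_{-1} = \binom{n_i - 1}{i-1} + \binom{n_{i-1}-1}{i-2} + \cdots + \binom{n_j - 1}{j-1},$$ where $\binom{m}{q} = 0$ whenever $m < q$. *)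

(* Defs.v *)
From HB Require Import structures.
From mathcomp Require Export all_boot all_algebra.
From mathcomp Require Export generic_quotient ring_quotient.
From mathcomp.multinomials Require Export mpoly.

Set Implicit Arguments.
Unset Strict Implicit.
Unset Printing Implicit Defensive.

Import GRing.Theory.
Local Open Scope ring_scope.
Local Open Scope quotient_scope.

(* The library makes {ideal_quot I} a commutative ring; for R = k[x_1,..,x_r]
   it is moreover a k-module, with c . [p] = [c . p]. *)
Section QuotientModule.
Variables (k : fieldType) (r : nat) (I : idealr {mpoly k[r]}).
Local Notation A := {ideal_quot I}.

Definition quot_scale (c : k) (a : A) : A := \pi_A c%:MP * a.

Lemma quot_scaleA c d a : quot_scale c (quot_scale d a) = quot_scale (c * d) a.
Proof. by rewrite /quot_scale mulrA -rmorphM mpolyCM. Qed.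

Lemma quot_scale1 : left_id 1 quot_scale.
Proof. by move=> a; rewrite /quot_scale mpolyC1 rmorph1 mul1r. Qed.

Lemma quot_scaleDr : right_distributive quot_scale +%R.
Proof. by move=> c a b; rewrite /quot_scale mulrDr. Qed.

Lemma quot_scaleDl a : {morph quot_scale^~ a : c d / c + d}.
Proof. by move=> c d; rewrite /quot_scale mpolyCD rmorphD mulrDl. Qed.

HB.instance Definition _ := GRing.Zmodule_isLmodule.Build k A
  quot_scaleA quot_scale1 quot_scaleDr quot_scaleDl.

Lemma pi_scale (c : k) (p : {mpoly k[r]}) : \pi_A (c *: p) = c *: \pi_A p.
Proof. by rewrite -mul_mpolyC rmorphM. Qed.

End QuotientModule.

(* The subspace W of V has k-dimension n: it has a basis with n elements. *)
Definition has_dim (k : fieldType) (V : lmodType k) (W : V -> Prop) (n : nat) :=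
  exists b : 'I_n -> V,
    [/\ forall j, W (b j),
        forall c : 'I_n -> k, \sum_j c j *: b j = 0 -> forall j, c j = 0
      & forall v, W v -> exists c : 'I_n -> k, v = \sum_j c j *: b j].

(* An idealr is a proper ideal, so the zero algebra (h_0 = 0) is excluded; it is
   a boolean predicate, which classically is no restriction. *)
Section GradedAlgebra.
Variables (k : fieldType) (r : nat) (I : idealr {mpoly k[r]}).
Local Notation A := {ideal_quot I}.

Definition homogeneous_ideal : Prop :=
  forall p, p \in I -> forall d, pihomog mdeg d p \in I.

Definition standard_graded_artinian : Prop :=
  homogeneous_ideal /\ exists n, has_dim (fun _ : A => True) n.

(* A_d, the image of R_d in A. *)
Definition graded_piece (d : nat) (a : A) : Prop :=
  exists2 p : {mpoly k[r]}, p \is d.-homog & a = \pi_A p.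

Definition hilbert_function (H : nat -> nat) : Prop :=
  forall d, has_dim (graded_piece d) (H d).

(* Multiplication by L from A_i to A_{i+1}. *)
Definition mul_injective (L : {mpoly k[r]}) (i : nat) : Prop :=
  forall a b, graded_piece i a -> graded_piece i b ->
    \pi_A L * a = \pi_A L * b -> a = b.

Definition mul_surjective (L : {mpoly k[r]}) (i : nat) : Prop :=
  forall b, graded_piece i.+1 b ->
    exists2 a, graded_piece i a & \pi_A L * a = b.

End GradedAlgebra.

(* R_1 is identified with the affine space k^r by the coefficients of a linear
   form; closed sets are the common zero loci of arbitrary sets S of
   polynomials. *)
Definition linear_form (k : fieldType) (r : nat) (a : 'I_r -> k) : {mpoly k[r]} :=
  \sum_j a j *: 'X_j.

Definition zariski_open (k : fieldType) (r : nat) (U : ('I_r -> k) -> Prop) :=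
  exists S : {mpoly k[r]} -> Prop,
    forall a, U a <-> ~ (forall f, S f -> f.@[a] = 0).

Definition WLP (k : fieldType) (r : nat) (I : idealr {mpoly k[r]}) : Prop :=
  exists U : ('I_r -> k) -> Prop,
    [/\ zariski_open U,
        exists a, U a
      & forall a, U a -> forall i,
          mul_injective I (linear_form a) i \/ mul_surjective I (linear_form a) i].

(* The top entries n_j < ... < n_i of an i-binomial expansion are the values
   m j, ..., m i of a function m; its other values are irrelevant. *)
Definition binomial_expansion (n i j : nat) (m : nat -> nat) : Prop :=
  [/\ (1 <= j <= i)%N,
      (j <= m j)%N,
      forall l, (j <= l < i)%N -> (m l < m l.+1)%N
    & n = (\sum_(j <= l < i.+1) 'C(m l, l))%N].

(* v = (n_(i))^{-1}_{-1}; the expansion of n > 0 exists and is unique, and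
   the truncated predecessors are harmless because m l >= l >= 1. *)
Definition binomial_lowering (n i v : nat) : Prop :=
  exists (j : nat) (m : nat -> nat),
    binomial_expansion n i j m /\
    v = (\sum_(j <= l < i.+1) 'C((m l).-1, l.-1))%N.

(* Main.v *)
(** Both directions rest on Green's hyperplane restriction theorem: for a
generic linear form [L], the rank of [L : A_(i-1) -> A_i] is at least
[(h_i)_(i)^{-1}_{-1}]; in particular this number never exceeds [h_(i-1)], which
is Macaulay's bound.

If equality holds for [i < t], then [L] is injective up to degree [t - 1]; in
degree [t] it is surjective since [(h_t)_(t)^{-1}_{-1} = h_t] when [h_t <= t],
and it stays surjective afterwards because [A] is generated in degree one.

If [h_(i-1) > (h_i)_(i)^{-1}_{-1}] for some [i < t], take the algebra of the lex
ideal with Hilbert function [H]. In it, all but [(h_i)_(i)^{-1}_{-1}] of the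
basis monomials of degree [i - 1] are killed by every linear form, so no linear
form is injective; none is surjective either, because
[(h_i)_(i)^{-1}_{-1} < h_i] when [h_i > i]. *)

Require Import Defs.
From HB Require Import structures.
From mathcomp Require Import zify.
From Stdlib Require Import Lia Classical ClassicalEpsilon.

Set Implicit Arguments.
Unset Strict Implicit.
Unset Printing Implicit Defensive.

(** * Lexicographic words and binomial expansions *)

(* The monomials of degree [d] in [y_0, ..., y_(v-1)] are listed so that those
   without the last variable come first, recursively; this is increasing order
   for the lexicographic comparison that looks at [y_(v-1)] first. Entry [i] of
   [word v d] tells whether [y_0] divides the i-th monomial. *)
Fixpoint word (v : nat) : nat -> seq bool :=
  if v is v'.+1 then
    fix w d := if d is d'.+1 then
                 word v' d'.+1 ++ (if v' is 0 then [:: true] else w d')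
               else [:: false]
  else fun d => if d is 0 then [:: false] else [::].

Local Notation sz v d := (size (word v d)).
(** For [d > 0] and [c] at most the length of the word, with [m_l] the entries of the [d]-binomial
    expansion of [c]: [wtrue] is the sum of the ['C(m_l - 1, l - 1)] and [wfalse], by Pascal's rule,
    Green's sum of the ['C(m_l - 1, l)]. *)
Definition wtrue v d c := count id (take c (word v d)).
Definition wfalse v d c := count negb (take c (word v d)).

Lemma word0 v : word v 0 = [:: false]. Proof. by case: v. Qed.
Lemma word1S d : word 1 d.+1 = [:: true]. Proof. by []. Qed.
Lemma wordSS v d : word v.+2 d.+1 = word v.+1 d.+1 ++ word v.+2 d.
Proof. by []. Qed.

Lemma size_wordS v d : sz v.+1 d.+1 = sz v d.+1 + sz v.+1 d.
Proof.
case: v => [|v]; last by rewrite wordSS size_cat.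
by case: d.
Qed.

Lemma size_word v d : sz v.+1 d = 'C(v + d, d).
Proof.
elim: v d => [|v IHv]; first by case=> [|d]; rewrite ?add0n ?binn.
elim=> [|d IHd]; first by rewrite word0 bin0.
by rewrite size_wordS IHv IHd !addnS addSn binS.
Qed.

Lemma size_word_gt0 v d : 0 < sz v.+1 d.
Proof. by rewrite size_word bin_gt0 leq_addl. Qed.

Lemma leq_size_word v d : v <= sz v d.+1.
Proof.
elim: v => // v IHv; rewrite size_wordS; have := size_word_gt0 v d. lia. Qed.

Lemma count_word v d : count id (word v.+1 d.+1) = sz v.+1 d.
Proof.
elim: v d => [|v IHv] d; first by case: d.
elim: d => [|d IHd]; rewrite wordSS count_cat IHv ?IHd; first by rewrite !word0.
by rewrite [RHS]size_wordS.
Qed.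

Lemma countN_word v d : count negb (word v.+1 d.+1) = sz v d.+1.
Proof.
have : count id (word v.+1 d.+1) + count negb (word v.+1 d.+1) = sz v.+1 d.+1.
  exact: count_predC.
by rewrite count_word size_wordS; lia.
Qed.

Lemma wtrueDfalse v d c : c <= sz v d -> wtrue v d c + wfalse v d c = c.
Proof. by move=> h; rewrite (count_predC id) size_takel. Qed.

(** Monomials free of a new variable come first, so adding it only appends entries. Hence the counts
    do not depend on the number of variables, once the word is long enough. *)
Lemma word_prefix v v' d : v <= v' -> prefix (word v d.+1) (word v' d.+1).
Proof.
elim: v' => [|v' IH]; first by case: v => //.
rewrite leq_eqVlt => /orP[/eqP->|/IH h]; first exact: prefix_refl.
apply: prefix_trans h _.
case: v' {IH} => [|v']; first by [].
rewrite wordSS; exact: prefix_prefix.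
Qed.

Lemma take_word v v' d c : c <= sz v d.+1 -> c <= sz v' d.+1 ->
  take c (word v d.+1) = take c (word v' d.+1).
Proof.
wlog le_v : v v' / v <= v' => [wl|].
  by case: (leqP v v') => [|/ltnW] h *; [apply: wl|apply/esym/wl].
by have /prefixP[s ->] := word_prefix d le_v => h _; rewrite takel_cat.
Qed.

Lemma wtrue_indep v v' d c : c <= sz v d.+1 -> c <= sz v' d.+1 ->
  wtrue v d.+1 c = wtrue v' d.+1 c.
Proof. by move=> h h'; rewrite /wtrue (take_word h h'). Qed.

Lemma wfalse_indep v v' d c : c <= sz v d.+1 -> c <= sz v' d.+1 ->
  wfalse v d.+1 c = wfalse v' d.+1 c.
Proof. by move=> h h'; rewrite /wfalse (take_word h h'). Qed.

Lemma wtrue_cat v d c :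
  wtrue v.+2 d.+1 (sz v.+1 d.+1 + c) = sz v.+1 d + wtrue v.+2 d c.
Proof.
by rewrite /wtrue wordSS take_cat ifN -?leqNgt ?leq_addr // count_cat count_word addKn.
Qed.

Lemma wfalse_cat v d c :
  wfalse v.+2 d.+1 (sz v.+1 d.+1 + c) = sz v d.+1 + wfalse v.+2 d c.
Proof.
by rewrite /wfalse wordSS take_cat ifN -?leqNgt ?leq_addr // count_cat countN_word addKn.
Qed.

Lemma count_take_mono (p : pred bool) (s : seq bool) m n :
  m <= n -> count p (take m s) <= count p (take n s).
Proof.
move=> le_mn; rewrite -(subnKC le_mn) takeD count_cat; exact: leq_addr.
Qed.

Lemma wtrue_mono v d m n : m <= n -> wtrue v d m <= wtrue v d n.
Proof. exact: count_take_mono. Qed.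

Lemma wfalse_mono v d m n : m <= n -> wfalse v d m <= wfalse v d n.
Proof. exact: count_take_mono. Qed.

Lemma wtrue_max v d c : wtrue v.+1 d.+1 c <= sz v.+1 d.
Proof.
rewrite -count_word -[in leqRHS](cat_take_drop c (word v.+1 d.+1)) count_cat.
exact: leq_addr.
Qed.

Lemma wfalse_max v d c : wfalse v.+1 d.+1 c <= sz v d.+1.
Proof.
rewrite -countN_word -[in leqRHS](cat_take_drop c (word v.+1 d.+1)) count_cat.
exact: leq_addr.
Qed.

(** In two variables the list is [y_0^d, y_0^(d-1) y_1, ..., y_1^d]. This is the source of the
    threshold: lowering fixes [c] when [c <= d] and decreases it beyond. *)
Lemma word_nseq v d : prefix (rcons (nseq d true) false) (word v.+2 d).
Proof.
case: d => [|d]; first by rewrite word0.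
suff -> : rcons (nseq d.+1 true) false = word 2 d.+1 by exact: word_prefix.
by elim: d => // d IH; rewrite wordSS word1S -IH.
Qed.

Lemma wtrue_small v d c : c <= d -> wtrue v.+2 d c = c.
Proof.
move=> le_cd; have /prefixP[s] := word_nseq v d.
rewrite /wtrue cat_rcons => ->.
by rewrite takel_cat ?size_nseq // take_nseq // count_nseq mul1n.
Qed.

Lemma wfalse_gt0 v d c : d < c -> 0 < wfalse v.+2 d c.
Proof.
move=> lt_dc; apply: leq_trans (wfalse_mono _ _ lt_dc).
have /prefixP[s] := word_nseq v d; rewrite /wfalse => ->.
by rewrite take_size_cat ?size_rcons ?size_nseq // -cats1 count_cat /=; lia.
Qed.

Lemma wtrue1 v d : wtrue v.+1 d.+1 1 = 1.
Proof.
rewrite (@wtrue_indep _ v.+2) ?wtrue_small //; exact: size_word_gt0.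
Qed.

Lemma wtrue_gt0 v d c : 0 < c -> 0 < wtrue v.+1 d.+1 c.
Proof. by move=> /(wtrue_mono v.+1 d.+1); rewrite wtrue1. Qed.

(** Double induction on variables and degree: a [c] inside the first block loses a variable, a
    larger one is shifted past that block and loses a degree. *)
Lemma word_exchange v d c : 0 < c <= sz v d.+1 ->
  wfalse v d (wtrue v d.+1 c).-1 < wtrue v d.+1 (wfalse v d.+1 c).+1.
Proof.
elim: v d c => [|v IHv] d c; first by rewrite leqn0 andbC => /andP[/eqP->].
elim: d c => [|d IHd] c => /andP[c_gt0 le_c].
  have -> : (wtrue v.+1 1 c).-1 = 0.
    by apply/eqP; have := wtrue_max v 0 c; rewrite word0 /=; lia.
  by rewrite {1}/wfalse take0; exact: wtrue_gt0.
case: v => [|v] in IHv IHd le_c *.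
  have -> : c = 1 by move: le_c; rewrite word1S /=; lia.
  by rewrite wtrue1 {1}/wfalse take0.
case: (leqP c (sz v.+1 d.+2)) => [le1|].
  have := IHv d.+1 c; rewrite c_gt0 le1 => /(_ isT).
  have sE := wtrueDfalse le1.
  have t0 : 0 < wtrue v.+1 d.+2 c by exact: wtrue_gt0.
  have tm := wtrue_max v d.+1 c.
  have szS := size_wordS v.+1 d.
  rewrite -(wtrue_indep le1 le_c) -(wfalse_indep le1 le_c).
  set T := wtrue v.+1 d.+2 c in sE t0 tm *; set U := wfalse v.+1 d.+2 c in sE *.
  rewrite (@wfalse_indep v.+1 v.+2 d T.-1); [|lia..].
  by rewrite (@wtrue_indep v.+1 v.+2 d.+1 U.+1) //; lia.
move=> lt_c; have [c0 def_c] : exists c0, c = sz v.+1 d.+2 + c0.+1.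
  by exists (c - sz v.+1 d.+2).-1; lia.
subst c; move: le_c; rewrite (size_wordS v.+1 d.+1) leq_add2l => le_c0.
have := IHd c0.+1; rewrite le_c0 => /(_ isT).
have t0 := wtrue_gt0 v.+1 d (ltn0Sn c0).
rewrite wtrue_cat wfalse_cat.
have -> : (sz v.+1 d.+1 + wtrue v.+2 d.+1 c0.+1).-1
          = sz v.+1 d.+1 + (wtrue v.+2 d.+1 c0.+1).-1 by lia.
rewrite wfalse_cat -(addnS (sz v d.+2)).
set T := wtrue v.+2 d.+1 c0.+1; set U := wfalse v.+2 d.+1 c0.+1.
have Umax : U <= sz v.+1 d.+1 by apply: wfalse_max.
clearbody T U.
have szv := size_wordS v d.+1.
have szv' := size_wordS v d.
have szv2 := size_wordS v.+1 d.
move=> IH.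
(* The position [sz v d.+2 + U.+1] stays in the block without the last variable exactly when
   [U < sz v.+1 d.+1]; otherwise [U] equals that bound and the position is one past the block. *)
case: (ltnP U (sz v.+1 d.+1)) => [ltU|geU]; last first.
  have -> : sz v d.+2 + U.+1 = sz v.+1 d.+2 + 1 by lia.
  rewrite wtrue_cat wtrue1.
  move: IH; have -> : U.+1 = sz v.+1 d.+1 + 1 by lia.
  rewrite wtrue_cat.
  have : wtrue v.+2 d 1 <= 1.
    by apply: leq_trans (count_size _ _) _; rewrite size_take_min geq_minl.
  lia.
have szw := size_wordS v.+1 d.+1.
rewrite (@wtrue_indep v.+2 v.+1 d.+1 (_ + U.+1)); [|lia..].
case: v => [|v] in IHv IHd le_c0 c_gt0 lt_c szv szv' szv2 szw T U Umax t0 ltU IH *.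
  have U0 : U = 0 by move: ltU; rewrite word1S /=; lia.
  by move: IH; rewrite U0 add0n !wtrue1; lia.
rewrite wtrue_cat.
by move: IH; rewrite (@wtrue_indep v.+3 v.+2 d U.+1); lia.
Qed.

(* [c_(d)^{-1}_{-1}] for [d > 0]: any number of variables giving at least [c]
   monomials of degree [d] may be used, here [c.+2]. *)
Definition low d c := wtrue c.+2 d c.

Lemma low_word v d c : c <= sz v d.+1 -> wtrue v d.+1 c = low d.+1 c.
Proof.
by move=> h; apply: wtrue_indep => //; apply: leq_trans (leq_size_word _ _); lia.
Qed.

Lemma low_mono d m n : m <= n -> low d.+1 m <= low d.+1 n.
Proof.
move=> le_mn; rewrite -(@low_word n.+2); first exact: wtrue_mono.
by apply: leq_trans (leq_size_word _ _); lia.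
Qed.

Lemma low_small d c : c <= d -> low d c = c.
Proof. exact: wtrue_small. Qed.

Lemma leq_size_word2 d c : c <= sz c.+2 d.+1.
Proof. by apply: leq_trans (leq_size_word _ _); lia. Qed.

Lemma low_lt d c : d.+1 < c -> low d.+1 c < c.
Proof.
move=> /(wfalse_gt0 c) h.
by have := wtrueDfalse (leq_size_word2 d c); rewrite -/(low _ _); lia.
Qed.

Lemma low_leq d c : low d c <= c.
Proof. by apply: leq_trans (count_size _ _) _; rewrite size_take_min geq_minl. Qed.

Lemma low1 c : 0 < c -> low 1 c = 1.
Proof.
move=> c_gt0; apply/eqP; rewrite eqn_leq wtrue_gt0 // andbT.
by have := wtrue_max c.+1 0 c; rewrite word0.
Qed.

(* The numerical step of Green's induction, with [c] the codimension of a
   subspace and [c'] the one after adding the multiples of a linear form. *)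
Lemma low_exchange d c c' : c' <= c ->
  c' <= (c' - low d.+2 c') + (c - c' - low d.+1 (c - c')) ->
  c' <= c - low d.+2 c.
Proof.
move=> le_c'c; case: (leqP c' (c - _)) => [//|lt_c'].
set v := c.+2; have v_ge n e : n <= c -> n <= sz v e.+1.
  by move=> h; apply: leq_trans (leq_size_word _ _); lia.
have c_gt0 : 0 < c by lia.
have := @word_exchange v d.+1 c; rewrite c_gt0 v_ge // => /(_ isT).
have cE := wtrueDfalse (v_ge c d.+1 (leqnn c)).
rewrite -!(@low_word v) ?v_ge //; [|lia..].
rewrite -(@low_word v) ?v_ge // in lt_c'.
have y_gt0 : 0 < wtrue v d.+2 c by exact: wtrue_gt0.
set x := wfalse v d.+2 c in cE *; set y := wtrue v d.+2 c in lt_c' cE y_gt0 *.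
(* As [x + y = c], the negated goal gives [c' > x] and [c - c' < y]. By monotonicity and
   [word_exchange], [wtrue] at [c'] then exceeds [wfalse] at [c - c'] one degree lower, against the
   hypothesis. *)
have lt1 : x.+1 <= c' by lia.
have le2 : c - c' <= y.-1 by lia.
have := wtrue_mono v d.+2 lt1; have := wfalse_mono v d.+1 le2.
have := wtrueDfalse (v_ge (c - c') d _); rewrite leq_subr => /(_ isT).
have := wtrueDfalse (v_ge c' d.+1 le_c'c).
lia.
Qed.

(** If degree [d + 2] overflowed the monomials in [h 1] variables, the first extra monomial, a
    multiple of [y_0], would push the lowering above the monomial count in degree [d + 1]. *)
Lemma leq_size_macaulay (h : nat -> nat) : h 0 = 1 -> 0 < h 1 ->
  (forall d, low d.+1 (h d.+1) <= h d) -> forall d, h d <= sz (h 1) d.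
Proof.
move=> h0 h1_gt0 hl; case def_h1: (h 1) h1_gt0 => [//|v] _.
elim=> [|[_|d IH]]; first by rewrite h0 word0.
  by rewrite def_h1 leq_size_word.
rewrite leqNgt; apply/negP => lt_h.
have := leq_trans (low_mono d.+1 lt_h) (hl d.+1).
rewrite -(addn1 (sz _ _)) -(@low_word v.+2); last first.
  by rewrite (size_wordS v.+1 d.+1) leq_add2l size_word_gt0.
by rewrite wtrue_cat wtrue1; lia.
Qed.

(** * Comparison with binomial expansions *)

Lemma expansion_bound i j (m : nat -> nat) :
  1 <= j <= i -> j <= m j -> (forall l, j <= l < i -> m l < m l.+1) ->
  i <= m i /\ \sum_(j <= l < i.+1) 'C(m l, l) < 'C((m i).+1, i).
Proof.
move=> /andP[j_gt0 le_ji] le_jm; elim: i le_ji => [|i IH]; first by lia.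
rewrite leq_eqVlt => /orP[/eqP <- _|lt_ji].
  split=> //; rewrite big_nat1; case: j j_gt0 le_jm {IH} => // j _ le_jm.
  by rewrite binS -{1}[X in X < _]addn0 ltn_add2l bin_gt0; lia.
move=> mono; have [||le_im ub] := IH; first by [].
  by move=> l hl; apply: mono; lia.
have lt_m : m i < m i.+1 by apply: mono; lia.
split; first by lia.
rewrite big_nat_recr /=; last by lia.
rewrite binS [ltnRHS]addnC ltn_add2r; apply: leq_trans ub _.
exact: leq_bin2l.
Qed.

(** The leading term ['C(m_i, i)] is the full block of degree [i] in [m_i - i + 1] variables, whose
    multiples of [y_0] number ['C(m_i - 1, i - 1)]; by [expansion_bound] the other terms fit in the
    next block, one degree lower. *)
Lemma low_expansion n i j m : binomial_expansion n i j m ->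
  \sum_(j <= l < i.+1) 'C((m l).-1, l.-1) = low i n.
Proof.
case=> /andP[j_gt0 le_ji] le_jm mono ->.
elim: i le_ji mono => [|i IH]; first by lia.
rewrite leq_eqVlt => /orP[/eqP def_j _|lt_ji mono].
  rewrite -def_j !big_nat1; case: j j_gt0 le_jm {def_j IH} => // j _ le_jm.
  have mE : m j.+1 = m j.+1 - j.+1 + j.+1 by rewrite subnK.
  have szE : 'C(m j.+1, j.+1) = sz (m j.+1 - j.+1).+1 j.+1.
    by rewrite size_word -mE.
  rewrite szE -(@low_word (m j.+1 - j.+1).+1) // /wtrue take_size count_word size_word /=.
  by congr 'C(_, _); lia.
have mono' l : j <= l < i -> m l < m l.+1 by move=> hl; apply: mono; lia.
have [|le_im ub] := @expansion_bound i j m _ le_jm mono'; first by lia.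
have lt_m : m i < m i.+1 by apply: mono; lia.
rewrite big_nat_recr /=; last by lia.
rewrite [in RHS]big_nat_recr /=; last by lia.
rewrite IH //; set n' := \sum_(_ <= _ < _) _ in ub *.
case: i => [|i] in IH lt_ji le_im mono mono' n' ub lt_m *; first by lia.
have mE : m i.+2 = m i.+2 - i.+2 + i.+2 by lia.
set s := m i.+2 - i.+2 in mE.
have le_n' : n' <= sz s.+2 i.+1.
  rewrite size_word; apply: leq_trans (ltnW ub) _.
  by apply: leq_bin2l; lia.
have -> : 'C(m i.+2, i.+2) = sz s.+1 i.+2 by rewrite size_word -mE.
rewrite addnC [in RHS]addnC -(@low_word s.+2 i.+1); last first.
  by rewrite [leqRHS](size_wordS s.+1 i.+1) leq_add2l.
rewrite wtrue_cat low_word // size_word; congr ('C(_, _) + _); lia.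
Qed.

(** The expansion is read off the nested blocks. The bound on the top entry, carried through the
    induction, keeps the entries strictly increasing when a leading term is added. *)
Lemma expansion_exists_word v d n : 0 < n <= sz v.+1 d.+1 ->
  exists j m, binomial_expansion n d.+1 j m /\ m d.+1 <= v + d.+1.
Proof.
have full u e : exists j m,
    binomial_expansion (sz u.+1 e.+1) e.+1 j m /\ m e.+1 <= u + e.+1.
  exists e.+1, (fun=> u + e.+1); split=> //; split; rewrite ?leqnn ?leq_addl //.
    by move=> l; lia.
  by rewrite big_nat1 size_word.
elim: v d n => [|v IHv] d n.
  move=> n1; have -> : n = sz 1 d.+1 by rewrite size_word add0n binn in n1 *; lia.
  exact: full.
elim: d n => [|d IHd] n /andP[n_gt0 le_n].
  exists 1, (fun=> n); split; last by move: le_n; rewrite size_word bin1.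
  by split=> //; [move=> l; lia | rewrite big_nat1 bin1].
case: (leqP n (sz v.+1 d.+2)) => [le1|lt_n].
  have [|j [m [e1 e2]]] := IHv d.+1 n; first by rewrite n_gt0.
  by exists j, m; split=> //; lia.
move: le_n; rewrite leq_eqVlt => /orP[/eqP->|]; first exact: full.
rewrite (size_wordS v.+1 d.+1) => lt_n2.
have [|j [m [[jd jm mono nE] ub]]] := IHd (n - sz v.+1 d.+2); first by lia.
have lt_m : m d.+1 < v + d.+2.
  suff : m d.+1 != v + d.+2 by lia.
  apply/eqP => mE; have : n - sz v.+1 d.+2 >= 'C(m d.+1, d.+1).
    by rewrite [leqRHS]nE big_nat_recr /=; [exact: leq_addl | lia].
  by rewrite mE [sz v.+2 _]size_word addSnnS in lt_n2 *; lia.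
exists j, (fun l => if l == d.+2 then v + d.+2 else m l); rewrite eqxx.
split; last by lia.
split; first by lia.
- by case: eqP => [|_ //]; lia.
- move=> l hl; have -> : l == d.+2 = false by lia.
  case: eqP => [[->] //|ne_l]; apply: mono; lia.
rewrite big_nat_recr /=; last by lia.
rewrite eqxx -size_word -(subnK (ltnW lt_n)) nE; congr (_ + _).
by apply: eq_big_nat => l hl; have -> : l == d.+2 = false by lia.
Qed.

Lemma binomial_loweringP n i v : 0 < i -> 0 < n ->
  binomial_lowering n i v <-> v = low i n.
Proof.
case: i => // d _ n_gt0; split=> [[j [m [mE ->]]]|->]; first exact: low_expansion.
have [|j [m [mE _]]] := @expansion_exists_word n.+1 d n.
  by rewrite n_gt0 leq_size_word2.
by exists j, m; split=> //; rewrite (low_expansion mE).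
Qed.

(** * Generic linear forms *)

Import GRing.Theory.
Local Open Scope ring_scope.

Lemma char0_nonroot (k : fieldType) (p : {poly k}) :
  [pchar k] =i pred0 -> p != 0 -> exists x, p.[x] != 0.
Proof.
move=> char0 p_neq0.
have inj : injective (fun n : nat => n%:R : k).
  have nat0 := (pcharf0P k).1 char0.
  suff le m n : (m <= n)%N -> m%:R = n%:R :> k -> m = n.
    move=> m n; case: (leqP m n) => [/le //|/ltnW /le h /esym /h].
    exact: esym.
  move=> le_mn /eqP; rewrite eq_sym -subr_eq0 -natrB // nat0; lia.
pose s := [seq n%:R : k | n <- iota 0 (size p)].
have s_uniq : uniq s by rewrite (map_inj_uniq inj) iota_uniq.
have : ~~ all (root p) s.
  apply/negP => /(max_poly_roots p_neq0) /(_ s_uniq).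
  by rewrite size_map size_iota ltnn.
by case/allPn => x _ nroot; exists x.
Qed.

Definition generic (k : fieldType) r (P : ('I_r -> k) -> Prop) :=
  exists2 f : {mpoly k[r]}, (exists a, f.@[a] != 0) &
    forall a, f.@[a] != 0 -> P a.

Lemma generic_ex (k : fieldType) r (P : ('I_r -> k) -> Prop) :
  generic P -> exists a, P a.
Proof. by case=> f [a fa0] fP; exists a; apply: fP. Qed.

Lemma generic_sub (k : fieldType) r (P Q : ('I_r -> k) -> Prop) :
  (forall a, P a -> Q a) -> generic P -> generic Q.
Proof. by move=> sPQ [f nz fP]; exists f => // a /fP /sPQ. Qed.

Lemma mpoly_line (k : fieldType) r (f : {mpoly k[r]}) (a b : 'I_r -> k) :
  exists q : {poly k}, forall t, q.[t] = f.@[fun i => a i + t * (b i - a i)].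
Proof.
exists (mmap polyC (fun i => (a i)%:P + 'X * (b i - a i)%:P) f) => t.
rewrite /meval /mmap horner_sum; apply: eq_bigr => m _.
rewrite hornerM hornerC /mmap1 horner_prod; congr (_ * _).
by apply: eq_bigr => i _; rewrite horner_exp !hornerE.
Qed.

(** A line joining a point of one open set to a point of the other reduces the claim to one
    variable: the restrictions are nonzero at [t = 0] and [t = 1] respectively, so their product is
    a nonzero polynomial. *)
Lemma generic_and (k : fieldType) r (P Q : ('I_r -> k) -> Prop) :
  [pchar k] =i pred0 ->
  generic P -> generic Q -> generic (fun a => P a /\ Q a).
Proof.
move=> char0 [f [a fa] fP] [g [b gb] gQ].
exists (f * g); last first.
  by move=> c; rewrite mevalM mulf_eq0 negb_or => /andP[/fP Pc /gQ].
have [p pE] := mpoly_line f a b; have [q qE] := mpoly_line g a b.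
have p0 : p.[0] != 0.
  rewrite pE; congr (_ != 0): fa; apply: mpoly.meval_eq => i.
  by rewrite mul0r addr0.
have q1 : q.[1] != 0.
  rewrite qE; congr (_ != 0): gb; apply: mpoly.meval_eq => i.
  by rewrite mul1r addrC subrK.
have pq_neq0 : p * q != 0.
  rewrite mulf_eq0 negb_or; apply/andP; split.
    by apply: contraNneq p0 => ->; rewrite horner0.
  by apply: contraNneq q1 => ->; rewrite horner0.
have [t] := char0_nonroot char0 pq_neq0.
by rewrite hornerM pE qE -mevalM => ?; eexists; eassumption.
Qed.

Lemma generic_all (k : fieldType) r (n : nat) (P : nat -> ('I_r -> k) -> Prop) :
  [pchar k] =i pred0 -> (forall i, (i < n)%N -> generic (P i)) ->
  generic (fun a => forall i, (i < n)%N -> P i a).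
Proof.
move=> char0; elim: n => [|n IH] gP.
  by exists 1 => //; exists (fun=> 0); rewrite meval1 oner_eq0.
apply: generic_sub (generic_and char0 (IH _) (gP n _)) => //.
  by move=> a [h1 h2] i; rewrite ltnS leq_eqVlt => /orP[/eqP->|/h1].
by move=> i lt_in; apply: gP; lia.
Qed.

Definition pencil (k : fieldType) r m n (M : 'I_r -> 'M[k]_(m, n))
    (a : 'I_r -> k) :=
  \sum_j a j *: M j.

(** Lower semicontinuity of the rank: [P] and [Q] cut [pencil M a0] down to an identity matrix, and
    [\det (P *m pencil M a *m Q)] is a polynomial in [a] whose nonvanishing bounds the rank from
    below. *)
Lemma generic_rank (k : fieldType) r m n (M : 'I_r -> 'M[k]_(m, n))
    (a0 : 'I_r -> k) :
  generic (fun a => (\rank (pencil M a0) <= \rank (pencil M a))%N).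
Proof.
set A0 := pencil M a0.
pose P := pinvmx (col_base A0); pose Q := pinvmx (row_base A0).
have PA0Q : P *m A0 *m Q = 1%:M.
  transitivity (P *m (col_base A0 *m row_base A0) *m Q).
    by rewrite mulmx_base.
  rewrite mulmxA mulVpmx ?col_base_full // mul1mx.
  by rewrite mulmxVp ?row_base_free.
pose B : 'M[{mpoly k[r]}]_(\rank A0) :=
  \matrix_(p, q) \sum_j (P *m M j *m Q) p q *: 'X_j.
have detB a : (\det B).@[a] = \det (P *m pencil M a *m Q).
  rewrite -det_map_mx; congr (\det _); apply/matrixP => p q.
  rewrite [in RHS]/pencil mulmx_sumr mulmx_suml summxE mxE mxE raddf_sum.
  apply: eq_bigr => j _; rewrite -scalemxAr -scalemxAl [RHS]mxE.
  by rewrite /= mevalZ mevalXU mulrC.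
exists (\det B); first by exists a0; rewrite detB PA0Q det1 oner_eq0.
move=> a; rewrite detB => det_neq0.
have : P *m pencil M a *m Q \in unitmx by rewrite unitmxE unitfE.
rewrite -row_free_unit -row_leq_rank => /leq_trans; apply.
by apply: leq_trans (mxrankM_maxl _ _) _; exact: mxrankM_maxr.
Qed.

(** * Green's theorem *)

(** A graded algebra in coordinates: row vectors of length [N d] stand for degree [d], and [X d j]
    for multiplication by [x_j]. The conditions are commutativity and generation in degree one. *)
Definition graded_multiplication (k : fieldType) r (N : nat -> nat)
    (X : forall d, 'I_r -> 'M[k]_(N d, N d.+1)) :=
  (forall d i j, X d i *m X d.+1 j = X d j *m X d.+1 i) /\
  (forall d m (W : 'M_(m, N d.+1)), (forall j, (X d j <= W)%MS) -> row_full W).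

Lemma pencil_delta (k : fieldType) r m n (M : 'I_r -> 'M[k]_(m, n)) j :
  pencil M (fun i => (i == j)%:R) = M j.
Proof.
rewrite /pencil (bigD1 j) //= eqxx scale1r big1 ?addr0 // => i /negbTE ->.
exact: scale0r.
Qed.

Lemma pencil_comm (k : fieldType) r (N : nat -> nat)
    (X : forall d, 'I_r -> 'M[k]_(N d, N d.+1)) d a b :
  (forall i j, X d i *m X d.+1 j = X d j *m X d.+1 i) ->
  pencil (X d) a *m pencil (X d.+1) b = pencil (X d) b *m pencil (X d.+1) a.
Proof.
move=> Xcomm; rewrite /pencil !mulmx_suml.
under eq_bigr do rewrite mulmx_sumr.
under [RHS]eq_bigr do rewrite mulmx_sumr.
rewrite exchange_big; apply: eq_bigr => j _; apply: eq_bigr => i _.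
by rewrite -!scalemxAl -!scalemxAr !scalerA Xcomm mulrC.
Qed.

Lemma mxrank_adds_coker (k : fieldType) m1 m2 n (W : 'M[k]_(m1, n)) (M : 'M_(m2, n)) :
  \rank (W + M)%MS = (\rank W + \rank (M *m cokermx W))%N.
Proof.
have kerE : (kermx (cokermx W) :=: W)%MS.
  by apply/eqmxP/andP; split; [rewrite submxE mulmx_ker | apply/sub_kermxP/mulmx_coker].
have := mxrank_mul_ker M (cokermx W); rewrite (cap_eqmx (eqmx_refl _) kerE).
have := mxrank_sum_cap W M; rewrite capmxC; lia.
Qed.

Lemma ex_minimum (T : Type) (f : T -> nat) (x0 : T) :
  exists x, forall y, (f x <= f y)%N.
Proof.
move: {2}(f x0) (leqnn (f x0)) => n; elim: n x0 => [|n IH] x0 le_n.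
  by exists x0 => y; lia.
case: (classic (exists y, (f y < f x0)%N)) => [[y lt_y]|none].
  by apply: (IH y); lia.
by exists x0 => y; rewrite leqNgt; apply/negP => lt_y; apply: none; exists y.
Qed.

Lemma pencil_enlarges (k : fieldType) r (N : nat -> nat)
    (X : forall d, 'I_r -> 'M[k]_(N d, N d.+1)) d m (W : 'M_(m, N d.+1)) :
  graded_multiplication X -> (\rank W < N d.+1)%N ->
  exists a, (\rank W < \rank (W + pencil (X d) a)%MS)%N.
Proof.
move=> [_ Xgen] rkW; case: (boolP [forall j, (X d j <= W)%MS]) => [/forallP sXW|].
  by have := Xgen d m W sXW; rewrite /row_full => /eqP; lia.
case/forallPn => j nXW; exists (fun i => (i == j)%:R); rewrite pencil_delta.
by apply: rank_ltmx; rewrite ltmxE addsmxSl addsmx_sub submx_refl.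
Qed.

(* The residual spaces of [W]: [W : L] in degree [d] and [W + L R_d] in degree
   [d + 1]; minimality of [codim (W + L R_d)] in [L] replaces the genericity of
   the hyperplane, and a second form [L'] is taken generic for both residuals. *)
Lemma green_step (k : fieldType) r (N : nat -> nat)
    (X : forall d, 'I_r -> 'M[k]_(N d, N d.+1)) d m (W : 'M_(m, N d.+2)) a :
  [pchar k] =i pred0 -> graded_multiplication X ->
  (forall b, \rank (W + pencil (X d.+1) b)%MS <= \rank (W + pencil (X d.+1) a)%MS)%N ->
  let W' := kermx (pencil (X d.+1) a *m cokermx W) in
  let W'' := (W + pencil (X d.+1) a)%MS in
  forall b1 b2,
  (N d.+2 - \rank W'' <= (N d.+2 - \rank (W'' + pencil (X d.+1) b2)%MS)
                        + (N d.+1 - \rank (W' + pencil (X d) b1)%MS))%N.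
Proof.
move=> char0 [Xcomm Xgen] amax W' W'' b1 b2.
pose C := cokermx W''; pose C' := cokermx W'.
have [b [gb2 gb1]] := generic_ex (generic_and char0
  (generic_rank (fun j => X d.+1 j *m C) b2) (generic_rank (fun j => X d j *m C') b1)).
have pencilM n p (M : 'I_r -> 'M[k]_(n, p)) q (D : 'M_(p, q)) c :
  pencil (fun j => M j *m D) c = pencil M c *m D.
  by rewrite /pencil mulmx_suml; apply: eq_bigr => j _; rewrite scalemxAl.
rewrite !pencilM in gb1 gb2.
have rk1 := mxrank_adds_coker W' (pencil (X d) b1).
have rk1' := mxrank_adds_coker W' (pencil (X d) b).
have rk2 := mxrank_adds_coker W'' (pencil (X d.+1) b2).
have rk2' := mxrank_adds_coker W'' (pencil (X d.+1) b).
set La := pencil (X d.+1) a in W' W'' C C' rk1 rk1' rk2 rk2' gb1 gb2 amax *.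
set Lb := pencil (X d.+1) b in rk2' gb2.
set lb := pencil (X d) b in rk1' gb1.
(* With [L], [L'] the forms of [a], [b]: both [W : L] and the multiples of [L'] lie in
   [(W + L' A) : L], the latter by commutativity. *)
have le_ker : (W' + lb <= kermx (La *m cokermx (W + Lb)%MS))%MS.
  rewrite addsmx_sub; apply/andP; split; apply/sub_kermxP; rewrite mulmxA; apply/eqP.
    rewrite -submxE; apply: submx_trans (addsmxSl _ _).
    by rewrite submxE -mulmxA; apply/eqP/mulmx_ker.
  rewrite -submxE; apply: submx_trans (addsmxSr _ _).
  by rewrite /lb /La pencil_comm //; apply: submxMl.
have := mxrankS le_ker; rewrite mxrank_ker.
have := mxrank_adds_coker (W + Lb)%MS La.
have -> : \rank (W + Lb + La)%MS = \rank (W'' + Lb)%MS.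
  by rewrite -!addsmxA [(Lb + La)%MS]addsmxC.
(* By the choice of [a], the codimension of [W''] is at most that of [W + Lb], which is the
   codimension of [W'' + Lb] plus that of the kernel in [le_ker]. *)
have := amax b; rewrite -/Lb -/W''.
have := rank_leq_row (La *m cokermx (W + Lb)%MS).
have := rank_leq_col (W'' + pencil (X d.+1) b2)%MS.
have := rank_leq_col (W'' + Lb)%MS.
have := rank_leq_col W''.
rewrite -/C in rk2 rk2'; rewrite -/C' in rk1 rk1'.
lia.
Qed.

(** Induction on the degree and, within it, on the codimension of [W]: the bound is applied to
    [W''], of smaller codimension, and to [W'], in lower degree; [green_step] and [low_exchange]
    combine the two. *)
Lemma green_restriction (k : fieldType) r (N : nat -> nat)
    (X : forall d, 'I_r -> 'M[k]_(N d, N d.+1)) d m (W : 'M_(m, N d.+1)) :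
  [pchar k] =i pred0 -> graded_multiplication X ->
  exists a, (N d.+1 - \rank (W + pencil (X d) a)%MS <=
             N d.+1 - \rank W - low d.+1 (N d.+1 - \rank W))%N.
Proof.
move=> char0 gradX; elim: d m W => [|d IHd] m W.
  have [rkW|rkW] := ltnP (\rank W) (N 1%N).
    have [a lt_a] := pencil_enlarges gradX rkW; exists a.
    by rewrite low1; lia.
  by exists (fun=> 0); have := mxrankS (addsmxSl W (pencil (X 0%N) (fun=> 0))); lia.
have [n le_n] := ubnP (N d.+2 - \rank W)%N.
elim: n m W le_n => // n IHn m W le_n.
have [rkW|rkW] := ltnP (\rank W) (N d.+2); last first.
  by exists (fun=> 0); have := mxrankS (addsmxSl W (pencil (X d.+1) (fun=> 0))); lia.
have [a amin] := ex_minimum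
  (fun a => N d.+2 - \rank (W + pencil (X d.+1) a)%MS)%N (fun=> 0).
have amax b : (\rank (W + pencil (X d.+1) b)%MS <= \rank (W + pencil (X d.+1) a)%MS)%N.
  have := amin b; have := rank_leq_col (W + pencil (X d.+1) b)%MS.
  by have := rank_leq_col (W + pencil (X d.+1) a)%MS; lia.
exists a.
have step := green_step char0 gradX amax; cbv zeta in step.
set W' := kermx _ in step; set W'' := (W + _)%MS in step *.
have lt_a : (\rank W < \rank W'')%N.
  by have [b /leq_trans] := pencil_enlarges gradX rkW; apply.
have [|b2 Hb2] := IHn _ W''; first by lia.
have [b1 Hb1] := IHd _ W'.
have := step b1 b2.
(* Multiplication by the form of [a] embeds the quotient by [W'] into the quotient by [W], with
   image [W'' / W]. *)
have rkW' : (N d.+1 - \rank W' = \rank W'' - \rank W)%N.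
  rewrite mxrank_ker mxrank_adds_coker.
  by have := rank_leq_row (pencil (X d.+1) a *m cokermx W); lia.
have := rank_leq_col W''.
have := @low_exchange d (N d.+2 - \rank W) (N d.+2 - \rank W'').
rewrite rkW' in Hb1.
have -> : (N d.+2 - \rank W - (N d.+2 - \rank W'') = \rank W'' - \rank W)%N.
  by have := rank_leq_col W''; lia.
lia.
Qed.

(** Green's bound at [W = 0], read as a rank, spreads from one form to generic forms by
    semicontinuity. *)
Lemma generic_low (k : fieldType) r (N : nat -> nat)
    (X : forall d, 'I_r -> 'M[k]_(N d, N d.+1)) d :
  [pchar k] =i pred0 -> graded_multiplication X ->
  generic (fun a => low d.+1 (N d.+1) <= \rank (pencil (X d) a))%N.
Proof.
move=> char0 gradX; have [a] := green_restriction (0 : 'M_(1, N d.+1)) char0 gradX.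
rewrite adds0mx mxrank0 subn0 => le_a.
apply: generic_sub (generic_rank (X d) a) => b; apply: leq_trans.
have := rank_leq_col (pencil (X d) a).
have : (low d.+1 (N d.+1) <= N d.+1)%N by rewrite low_leq.
lia.
Qed.

(** * Multiplication matrices of a graded algebra *)

Section MultiplicationSystem.
Local Open Scope quotient_scope.
Variables (k : fieldType) (r : nat) (I : idealr {mpoly k[r]}) (H : nat -> nat).
Local Notation A := {ideal_quot I}.

Lemma graded_pieceD d (a b : A) :
  graded_piece d a -> graded_piece d b -> graded_piece d (a + b).
Proof.
by move=> [p hp ->] [q hq ->]; exists (p + q); rewrite ?rmorphD ?dhomogD.
Qed.

Lemma graded_pieceZ d c (a : A) : graded_piece d a -> graded_piece d (c *: a).
Proof. by move=> [p hp ->]; exists (c *: p); rewrite ?pi_scale ?dhomogZ. Qed.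

Lemma graded_piece_sum d (J : finType) (F : J -> A) :
  (forall j, graded_piece d (F j)) -> graded_piece d (\sum_j F j).
Proof.
move=> hF; apply: (big_ind (@graded_piece k r I d)) => //.
  by exists 0; rewrite ?rmorph0 ?dhomog0.
exact: graded_pieceD.
Qed.

Lemma graded_pieceX d j (a : A) :
  graded_piece d a -> graded_piece d.+1 (\pi_A 'X_j * a).
Proof.
move=> [p hp ->]; exists ('X_j * p); last by rewrite rmorphM.
by rewrite -add1n; apply: dhomogM => //; rewrite dhomogX; apply/eqP/mdeg1.
Qed.

Lemma quot_scaleAl (c : k) (a b : A) : c *: (a * b) = c *: a * b.
Proof. exact: mulrA. Qed.

Lemma quot_scaleAr (c : k) (a b : A) : c *: (a * b) = a * (c *: b).
Proof. by rewrite mulrC quot_scaleAl mulrC. Qed.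

Lemma pi_linear_form (a : 'I_r -> k) :
  \pi_A (linear_form a) = \sum_j a j *: \pi_A 'X_j.
Proof. by rewrite rmorph_sum; apply: eq_bigr => j _; exact: pi_scale. Qed.

Definition combine n (b : 'I_n -> A) (u : 'rV[k]_n) : A := \sum_j u 0 j *: b j.

Lemma combineD n (b : 'I_n -> A) u v :
  combine b (u + v) = combine b u + combine b v.
Proof. by rewrite -big_split; apply: eq_bigr => j _; rewrite mxE scalerDl. Qed.

Lemma combineZ n (b : 'I_n -> A) c u : combine b (c *: u) = c *: combine b u.
Proof. by rewrite scaler_sumr; apply: eq_bigr => j _; rewrite mxE scalerA. Qed.

Lemma combineB n (b : 'I_n -> A) u v :
  combine b (u - v) = combine b u - combine b v.
Proof. by rewrite combineD -[- v]scaleN1r combineZ scaleN1r. Qed.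

Lemma combine_sum n (b : 'I_n -> A) J (s : seq J) (F : J -> 'rV_n) :
  combine b (\sum_(j <- s) F j) = \sum_(j <- s) combine b (F j).
Proof.
elim: s => [|j s IH]; last by rewrite !big_cons combineD IH.
by rewrite !big_nil; apply: big1 => j _; rewrite mxE scale0r.
Qed.

Lemma mdegS_split (m : 'X_{1..r}) d :
  mdeg m = d.+1 -> exists j m', m = (U_(j) + m')%MM /\ mdeg m' = d.
Proof.
move=> md; have [j mj] : exists j, m j != 0%N.
  apply/existsP; rewrite -negb_forall; apply/negP => /forallP m0.
  by move: md; rewrite mdegE big1 // => j _; apply/eqP/m0.
have le_j : (U_(j) <= m)%MM.
  apply/mnm_lepP => i; rewrite mnm1E; case: eqP => [<-|//]; by rewrite lt0n.
exists j, (m - U_(j))%MM; rewrite addmC submK //; split=> //.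
have /(congr1 mdeg) := submK le_j.
by rewrite mdegD mdeg1 md addn1 => -[].
Qed.

(** Bases chosen in every degree turn linear forms into pencils acting on row vectors from the
    right. Generation holds because each monomial of degree [d + 1] is some [x_j] times one of
    degree [d]. *)
Lemma multiplication_system : hilbert_function I H ->
  exists X : forall d, 'I_r -> 'M[k]_(H d, H d.+1),
  [/\ graded_multiplication X,
      forall d a, row_free (pencil (X d) a) -> mul_injective I (linear_form a) d
    & forall d a, row_full (pencil (X d) a) -> mul_surjective I (linear_form a) d].
Proof.
move=> hH; pose bS d := constructive_indefinite_description _ (hH d).
pose b d := proj1_sig (bS d).
have b_in d j : graded_piece d (b d j) by have [h _ _] := proj2_sig (bS d); exact: h.
have comb_in d u : graded_piece d (combine (b d) u).
  by apply: graded_piece_sum => j; apply: graded_pieceZ.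
have comb_inj d u v : combine (b d) u = combine (b d) v -> u = v.
  move=> /eqP; rewrite -subr_eq0 -combineB => /eqP e.
  have [_ /(_ _ e) uv0 _] := proj2_sig (bS d).
  by apply/eqP; rewrite -subr_eq0; apply/eqP/rowP => j; rewrite uv0 mxE.
have comb_onto d v : graded_piece d v -> exists u, v = combine (b d) u.
  have [_ _ h] := proj2_sig (bS d); move=> /h [c ->]; exists (\row_j c j).
  by apply: eq_bigr => j _; rewrite mxE.
pose coord d v := epsilon (inhabits 0) (fun u => v = combine (b d) u).
have coordK d v : graded_piece d v -> combine (b d) (coord d v) = v.
  by move=> /comb_onto h; rewrite -(epsilon_spec (inhabits 0) _ h).
pose X d j := \matrix_p coord d.+1 (\pi_A 'X_j * b d p).
have combX d j u : combine (b d.+1) (u *m X d j) = \pi_A 'X_j * combine (b d) u.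
  rewrite mulmx_sum_row combine_sum mulr_sumr; apply: eq_bigr => p _.
  by rewrite combineZ rowK coordK ?quot_scaleAr //; apply: graded_pieceX.
have combL d a u :
    combine (b d.+1) (u *m pencil (X d) a) = \pi_A (linear_form a) * combine (b d) u.
  rewrite /pencil mulmx_sumr combine_sum pi_linear_form mulr_suml.
  by apply: eq_bigr => j _; rewrite -scalemxAr combineZ combX quot_scaleAl.
exists X; split.
- split=> [d i j|d m W sXW].
    apply/row_matrixP => p; rewrite !rowE !mulmxA; apply: (comb_inj d.+2).
    by rewrite !combX mulrCA.
  rewrite -sub1mx; apply/row_subP => p; set u := row p 1%:M.
  have [f hf uE] := comb_in d.+1 u.
  have monW mm : mm \in msupp f -> (coord d.+1 (\pi_A 'X_[mm]) <= W)%MS.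
    move=> /(dhomog_mf hf) /mdegS_split [j [m' [-> dm']]].
    have hm' : graded_piece d (\pi_A 'X_[m']).
      by exists 'X_[m'] => //; rewrite dhomogX; apply/eqP.
    suff -> : coord d.+1 (\pi_A 'X_[U_(j) + m']) = coord d (\pi_A 'X_[m']) *m X d j.
      exact: submx_trans (submxMl _ _) (sXW j).
    apply: comb_inj; rewrite combX !coordK // mpolyXD rmorphM //.
    exact: graded_pieceX.
  have -> : u = \sum_(mm <- msupp f) f@_mm *: coord d.+1 (\pi_A 'X_[mm]).
    apply: comb_inj; rewrite uE [in LHS](mpolyE f) rmorph_sum combine_sum.
    apply: eq_big_seq => mm mf; rewrite [LHS]pi_scale combineZ coordK //.
    by exists 'X_[mm] => //; rewrite dhomogX; apply/eqP/(dhomog_mf hf mf).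
  rewrite big_seq; apply: (big_ind (fun w => (w <= W)%MS)).
  - exact: sub0mx.
  - by move=> x y; apply: addmx_sub.
  - by move=> mm /monW; apply: scalemx_sub.
- move=> d a free x y /comb_onto[u ->] /comb_onto[v ->].
  rewrite -!combL => /comb_inj; by move/(row_free_inj free) ->.
- move=> d a full y /comb_onto[v ->].
  exists (combine (b d) (v *m pinvmx (pencil (X d) a))) => //.
  by rewrite -combL mulmxKpV // submx_full.
Qed.

End MultiplicationSystem.

(** * The lex algebra *)

(** The monomials behind [word], in a fixed ring of [n.+1] variables so that [inord v'] has a type;
    the listing is faithful for [v <= n.+1]. *)
Fixpoint lexmons n (v : nat) : nat -> seq 'X_{1..n.+1} :=
  if v is v'.+1 then
    fix w d := if d is d'.+1 then
                 lexmons n v' d'.+1 ++ [seq (U_(inord v') + m)%MM | m <- w d']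
               else [:: 0%MM]
  else fun d => if d is 0%N then [:: 0%MM] else [::].

Section LexMonomials.
Local Open Scope nat_scope.
Variable n : nat.
Implicit Types (v d c : nat) (m u : 'X_{1..n.+1}) (j : 'I_n.+1).
Local Notation mons := (lexmons n).

Lemma lexmonsSS v d :
  mons v.+1 d.+1 = mons v d.+1 ++ [seq (U_(inord v) + m)%MM | m <- mons v.+1 d].
Proof. by []. Qed.

Lemma size_lexmons v d : size (mons v d) = size (word v d).
Proof.
elim: v d => [|v IHv] d; first by case: d.
elim: d => [|d IHd]; first by [].
by rewrite lexmonsSS size_cat size_map IHv IHd size_wordS.
Qed.

Lemma mem_lexmons v d m : v <= n.+1 ->
  reflect (mdeg m = d /\ forall j, v <= j -> m j = 0) (m \in mons v d).
Proof.
move=> le_v; apply: (iffP idP).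
  elim: v d le_v m => [|v IHv] d le_v m.
    case: d => [|d]; rewrite ?in_nil // inE => /eqP->; rewrite mdeg0.
    by split=> // j _; rewrite mnm0E.
  elim: d m => [|d IHd] m.
    by rewrite inE => /eqP->; rewrite mdeg0; split=> // j _; rewrite mnm0E.
  rewrite lexmonsSS mem_cat => /orP[/IHv|/mapP[u /IHd[du u0] ->]].
    by case; [lia | move=> dm m0; split=> // j hj; apply: m0; lia].
  rewrite mdegD mdeg1 du; split=> // j hj; rewrite mnmDE mnm1E u0 // addn0.
  by case: eqP => // e; move: hj; rewrite -e inordK ?ltnn.
elim: v d le_v m => [|v IHv] d le_v m.
  case=> dm m0; have m_eq0 : m = 0%MM by apply/mnmP => j; rewrite mnm0E m0.
  by rewrite -dm m_eq0 mdeg0 inE.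
elim: d m => [|d IHd] m [dm m0].
  by rewrite inE -mdeg_eq0 dm.
rewrite lexmonsSS mem_cat; case: (posnP (m (inord v))) => [mv0|mv].
  rewrite IHv //; first by lia.
  split=> // j; rewrite leq_eqVlt => /orP[/eqP vj|/m0 //].
  by have -> : j = inord v by apply: val_inj; rewrite /= inordK.
have le_m : (U_(inord v) <= m)%MM.
  by apply/mnm_lepP => j; rewrite mnm1E; case: eqP => [<-|].
apply/orP; right; apply/mapP; exists (m - U_(inord v))%MM; last first.
  by rewrite addmC submK.
apply: IHd; split; last by move=> j hj; rewrite mnmBE m0.
have /(congr1 (@mdeg _)) := submK le_m.
by rewrite mdegD mdeg1 dm; lia.
Qed.

Lemma uniq_lexmons v d : v <= n.+1 -> uniq (mons v d).
Proof.
elim: v d => [|v IHv] d le_v; first by case: d.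
elim: d => [//|d IHd]; rewrite lexmonsSS cat_uniq IHv ?(ltnW le_v) //=.
rewrite (map_inj_uniq (@addmI _ _)) IHd andbT -all_predC all_map.
apply/allP => m _ /=; apply/negP => /(mem_lexmons _ _ (ltnW le_v)) [_ /(_ (inord v))].
by rewrite inordK // leqnn mnmDE mnm1E eqxx => /(_ isT).
Qed.

Lemma mem_take_leq (T : eqType) (s : seq T) c c' x :
  c <= c' -> x \in take c s -> x \in take c' s.
Proof. by move=> le_c; rewrite -(subnKC le_c) takeD mem_cat => ->. Qed.

(** Exchanging [x_j] for [x_0] moves a monomial no later in the list, so [m] is a quotient by [x_0]
    of a listed monomial, and such quotients form an initial segment. The proof follows the block
    recursion. *)
Lemma lexmons_quotient v d c m j : v <= n.+1 -> c <= size (word v d.+1) ->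
  (U_(j) + m)%MM \in take c (mons v d.+1) ->
  m \in take (wtrue v d.+1 c) (mons v d).
Proof.
have in_mons v' d' u : v' <= n.+1 -> (U_(j) + u)%MM \in mons v' d'.+1 -> u \in mons v' d'.
  move=> le_v' /(mem_lexmons _ _ le_v')[]; rewrite mdegD mdeg1 add1n => -[du] h.
  apply/(mem_lexmons _ _ le_v'); split=> // i /h.
  by rewrite mnmDE => /eqP; rewrite addn_eq0 => /andP[_ /eqP].
have one w e b u : w < n.+1 -> size (word w.+1 e) = 1 ->
    (U_(j) + u)%MM \in take b (mons w.+1 e.+1) ->
    u \in take (wtrue w.+1 e.+1 b) (mons w.+1 e).
  move=> lt_w sz1 hu; rewrite take_oversize; first exact: in_mons (mem_take hu).
  by rewrite size_lexmons sz1 wtrue_gt0 //; case: b hu => //; rewrite take0.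
elim: v d c m => [|v IHv] d c m le_v; first by [].
elim: d c m => [|d IHd] c m le_c; first exact: one.
case: v => [|v] in IHv IHd le_v le_c *; first exact: one.
have size1 := size_lexmons v.+1 d.+2.
case: (leqP c (size (word v.+1 d.+2))) => [le1|lt_c].
  rewrite lexmonsSS takel_cat ?size1 // => /(IHv _ _ _ (ltnW le_v) le1) hm.
  by rewrite -(wtrue_indep le1 le_c) lexmonsSS takel_cat ?size_lexmons ?wtrue_max.
have [c0 def_c] : exists c0, c = size (word v.+1 d.+2) + c0.
  by exists (c - size (word v.+1 d.+2)); lia.
subst c; move: le_c; rewrite (size_wordS v.+1 d.+1) leq_add2l => le_c0.
rewrite wtrue_cat lexmonsSS take_cat size1 ifN -?leqNgt ?leq_addr // addKn.
rewrite mem_cat => /orP[/(in_mons _ _ _ (ltnW le_v)) hm|].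
  by rewrite lexmonsSS take_cat size_lexmons ifN -?leqNgt ?leq_addr // mem_cat hm.
rewrite -map_take => /mapP[u hu e].
(* If [x_j] is the last variable, [m] is among the first [c0] monomials, and [wfalse] is at most the
   size of the first block. Otherwise the last variable divides [m] and the induction on the degree
   applies. *)
case: (eqVneq j (inord v.+1)) => [jv|jv].
  have -> : m = u by apply: (@addmI _ U_(j)%MM); rewrite e jv.
  apply: mem_take_leq hu; have := wtrueDfalse le_c0; have := wfalse_max v.+1 d c0.
  lia.
have le_u : (U_(j) <= u)%MM.
  apply/mnm_lepP => i; rewrite mnm1E; case: eqP => [<-|//].
  have /(congr1 (fun mm : 'X_{1..n.+1} => mm j)) := e.
  by rewrite !mnmDE !mnm1E eqxx eq_sym (negbTE jv); lia.
have mE : m = (U_(inord v.+1) + (u - U_(j)))%MM.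
  apply: (@addmI _ U_(j)%MM); rewrite e addmA [(U_(j) + _)%MM]addmC -addmA.
  by congr (_ + _)%MM; rewrite addmC submK.
rewrite lexmonsSS take_cat size_lexmons ifN -?leqNgt ?leq_addr // addKn mem_cat.
apply/orP; right; rewrite -map_take mE; apply: map_f.
by apply: IHd => //; rewrite addmC submK.
Qed.

End LexMonomials.

(** * Quotients by monomial ideals *)

Section MonomialIdeal.
Local Open Scope quotient_scope.
Variables (k : fieldType) (r : nat) (std : pred 'X_{1..r}).
Hypothesis std0 : std 0%MM.
Hypothesis stdM : forall j m, std (U_(j) + m)%MM -> std m.

(** The span of the nonstandard monomials: [stdM] makes it an ideal and [std0] makes it proper. *)
Definition monomial_ideal_pred (p : {mpoly k[r]}) : bool :=
  all (predC std) (msupp p).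

Lemma std_dvd m m' : std (m' + m)%MM -> std m.
Proof.
move: {2}(mdeg m') (erefl (mdeg m')) => d; elim: d m' => [|d IH] m' dm'.
  by move/eqP: dm'; rewrite mdeg_eq0 => /eqP ->; rewrite add0m.
have [j [m1 [-> dm1]]] := mdegS_split dm'.
by rewrite -addmA => /stdM; apply: IH.
Qed.

Lemma monomial_ideal_closed : idealr_closed monomial_ideal_pred.
Proof.
split; first by rewrite unfold_in msupp0.
  by rewrite unfold_in msupp1 /= std0.
move=> f p q /allP hp /allP hq; apply/allP => m /msuppD_le.
rewrite mem_cat => /orP[/msuppM_le/allpairsP[[m1 m2] /= [_ hm2 ->]]|/hq //].
by apply: contra (hp _ hm2); apply: std_dvd.
Qed.

Definition monomial_ideal : idealr {mpoly k[r]} :=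
  HB.pack monomial_ideal_pred (isIdealr.Build _ _ monomial_ideal_closed).

Local Notation A := {ideal_quot monomial_ideal}.

Lemma mem_monomial_ideal p :
  (p \in monomial_ideal) = all (predC std) (msupp p).
Proof. by []. Qed.

Lemma pi_eq0 (p : {mpoly k[r]}) : (\pi_A p == 0) = (p \in monomial_ideal).
Proof. by rewrite -[p in RHS]subr0 Quotient.idealrBE rmorph0. Qed.

Lemma pi_std_neq0 m : std m -> \pi_A 'X_[m] != 0.
Proof. by move=> sm; rewrite pi_eq0 mem_monomial_ideal msuppX /= sm. Qed.

Lemma pi_nonstd m : ~~ std m -> \pi_A 'X_[m] = 0.
Proof. by move=> sm; apply/eqP; rewrite pi_eq0 mem_monomial_ideal msuppX /= sm. Qed.

Lemma monomial_ideal_homogeneous : homogeneous_ideal monomial_ideal.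
Proof.
move=> p; rewrite mem_monomial_ideal => /allP hp d.
rewrite pihomogE big_seq_cond; apply: rpred_sum => m /andP[/hp nm _].
by rewrite mem_monomial_ideal; apply/allP => m' /msuppZ_le; rewrite msuppX inE => /eqP ->.
Qed.

Lemma monomial_span (s : seq 'X_{1..r}) (p : {mpoly k[r]}) :
  uniq s -> (forall m, m \in msupp p -> std m -> m \in s) ->
  \pi_A p = \sum_(m <- s) p@_m *: \pi_A 'X_[m].
Proof.
move=> s_uniq ps; rewrite {1}(mpolyE p) rmorph_sum /=.
under eq_bigr do rewrite pi_scale.
rewrite (bigID (mem s)) /= [X in _ + X]big_seq_cond [X in _ + X]big1 ?addr0; last first.
  move=> m /andP[mp ms]; rewrite pi_nonstd ?scaler0 //.
  by apply: contraNN ms; apply: ps.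
rewrite [RHS](bigID (mem (msupp p))) /= [X in _ = _ + X]big1 ?addr0; last first.
  by move=> m; rewrite -mcoeff_eq0 => /eqP ->; rewrite scale0r.
rewrite -big_filter -[RHS]big_filter; apply: perm_big; apply: uniq_perm.
- by rewrite filter_uniq.
- by rewrite filter_uniq.
by move=> m; rewrite !mem_filter andbC.
Qed.

Lemma monomial_has_dim (W : A -> Prop) (s : seq 'X_{1..r}) :
  uniq s -> all std s -> (forall m, m \in s -> W (\pi_A 'X_[m])) ->
  (forall a, W a -> exists2 p, a = \pi_A p &
     forall m, m \in msupp p -> std m -> m \in s) ->
  has_dim W (size s).
Proof.
move=> s_uniq /allP s_std sW Ws.
exists (fun j => \pi_A 'X_[tnth (in_tuple s) j]); split.
- by move=> j; apply: sW; apply: mem_tnth.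
- move=> c c0 j; pose p := \sum_j c j *: 'X_[tnth (in_tuple s) j] : {mpoly k[r]}.
  have pj : p@_(tnth (in_tuple s) j) = c j.
    rewrite raddf_sum (bigD1 j) //= mcoeffZ mcoeffX eqxx mulr1 big1 ?addr0 // => i ne_ij.
    rewrite mcoeffZ mcoeffX (inj_eq (tuple_uniqP _ _)) // (negbTE ne_ij) mulr0 //.
  have : p \in monomial_ideal.
    rewrite -pi_eq0 rmorph_sum; apply/eqP; rewrite -[RHS]c0.
    by apply: eq_bigr => i _; apply: pi_scale.
  rewrite mem_monomial_ideal => /allP /(_ (tnth (in_tuple s) j)) h.
  apply/eqP; rewrite -pj mcoeff_eq0; apply/negP => /h /=.
  by rewrite s_std // mem_tnth.
move=> a /Ws [p -> ps]; exists (fun j => p@_(tnth (in_tuple s) j)).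
by rewrite (monomial_span s_uniq ps) big_tnth.
Qed.

End MonomialIdeal.

Lemma has_dim_leq (k : fieldType) (V : lmodType k) (W : V -> Prop) n l
    (w : 'I_l -> V) :
  has_dim W n -> (forall v, W v -> exists c : 'I_l -> k, v = \sum_q c q *: w q) ->
  (n <= l)%N.
Proof.
move=> [b [bW bfree _]] Ww.
pose coef p := proj1_sig (constructive_indefinite_description _ (Ww _ (bW p))).
have coefE p : b p = \sum_q coef p q *: w q.
  exact: proj2_sig (constructive_indefinite_description _ (Ww _ (bW p))).
pose M : 'M[k]_(n, l) := \matrix_(p, q) coef p q.
suff /eqP <- : row_free M by apply: rank_leq_col.
apply/inj_row_free => x xM0; apply/rowP => p; rewrite mxE.
apply: (bfree (fun p => x 0 p)).
under eq_bigr do rewrite coefE scaler_sumr.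
rewrite exchange_big big1 // => q _.
under eq_bigr do rewrite scalerA.
rewrite -scaler_suml; have /rowP/(_ q) := xM0; rewrite !mxE => xMq.
rewrite [X in X *: _](_ : _ = 0) ?scale0r // -[RHS]xMq.
by apply: eq_bigr => i _; rewrite mxE.
Qed.

(** * The lex ideal with a given Hilbert function *)

Section LexAlgebra.
Local Open Scope quotient_scope.
Variables (k : fieldType) (H : nat -> nat) (e n : nat).
Hypothesis H0 : H 0 = 1%N.
Hypothesis H1 : H 1 = n.+1.
Hypothesis He : forall i, (e < i)%N -> H i = 0%N.
Hypothesis macaulay : forall d, (low d.+1 (H d.+1) <= H d)%N.

(** The list being increasing, keeping the first [H d] monomials puts the lex-largest ones into the
    ideal. *)
Definition lex_basis d : seq 'X_{1..n.+1} := take (H d) (lexmons n n.+1 d).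

Definition lex_std (m : 'X_{1..n.+1}) : bool := m \in lex_basis (mdeg m).

Lemma leq_size_lexmons d : (H d <= size (lexmons n n.+1 d))%N.
Proof.
by rewrite size_lexmons -H1; apply: leq_size_macaulay; rewrite ?H1.
Qed.

Lemma size_lex_basis d : size (lex_basis d) = H d.
Proof. by rewrite size_takel // leq_size_lexmons. Qed.

Lemma uniq_lex_basis d : uniq (lex_basis d).
Proof. by rewrite take_uniq // uniq_lexmons. Qed.

Lemma mem_lex_basis d m : (m \in lex_basis d) = (mdeg m == d) && lex_std m.
Proof.
apply/idP/andP => [hm|[/eqP <- //]].
have /(mem_lexmons _ _ (leqnn _))[dm _] := mem_take hm.
by rewrite /lex_std dm.
Qed.

Lemma lex_std0 : lex_std 0%MM.
Proof. by rewrite /lex_std mdeg0 /lex_basis H0 inE. Qed.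

Lemma lex_std_quotient j m : lex_std (U_(j) + m)%MM ->
  m \in take (low (mdeg m).+1 (H (mdeg m).+1)) (lexmons n n.+1 (mdeg m)).
Proof.
rewrite /lex_std mdegD mdeg1 add1n => /lexmons_quotient.
have le_H := leq_size_lexmons (mdeg m).+1; rewrite size_lexmons in le_H.
by rewrite low_word //; apply.
Qed.

Lemma lex_stdM j m : lex_std (U_(j) + m)%MM -> lex_std m.
Proof. by move=> /lex_std_quotient; apply: mem_take_leq. Qed.

Definition lex_ideal : idealr {mpoly k[n.+1]} :=
  monomial_ideal k lex_std0 lex_stdM.

Local Notation A := {ideal_quot lex_ideal}.

Lemma hilbert_lex_ideal : hilbert_function lex_ideal H.
Proof.
move=> d; rewrite -[H d](size_lex_basis d).
apply: monomial_has_dim; first exact: uniq_lex_basis.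
- by apply/allP => m; rewrite mem_lex_basis => /andP[].
- move=> m; rewrite mem_lex_basis => /andP[dm _].
  by exists 'X_[m] => //; rewrite dhomogX.
move=> a [p hp ->]; exists p => // m mp sm.
by rewrite mem_lex_basis sm andbT; apply/eqP/(dhomog_mf hp).
Qed.

Lemma artinian_lex_ideal : standard_graded_artinian lex_ideal.
Proof.
split; first exact: monomial_ideal_homogeneous.
pose s := undup (flatten [seq lex_basis d | d <- iota 0 e.+1]).
exists (size s); apply: monomial_has_dim => //; first exact: undup_uniq.
- apply/allP => m; rewrite mem_undup => /flatten_mapP[d _].
  by rewrite mem_lex_basis => /andP[].
move=> a _; exists (repr a) => [|m _ sm]; first by rewrite reprK.
rewrite mem_undup; apply/flatten_mapP; exists (mdeg m) => //.
rewrite mem_iota add0n ltnS /= leqNgt; apply/negP => /He H_eq0.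
by move: sm; rewrite /lex_std /lex_basis H_eq0 take0.
Qed.

(** A standard [x_j m] would force [m] into the initial segment of [lex_std_quotient]; hence every
    variable kills [m]. *)
Lemma lex_socle a d m : m \in lex_basis d ->
  m \notin take (low d.+1 (H d.+1)) (lexmons n n.+1 d) ->
  \pi_A (linear_form a) * \pi_A 'X_[m] = 0.
Proof.
rewrite mem_lex_basis => /andP[/eqP <- _] nm.
rewrite pi_linear_form mulr_suml big1 // => j _.
suff Xm0 : \pi_A 'X_j * \pi_A 'X_[m] = 0 by rewrite -quot_scaleAl Xm0 scaler0.
rewrite -rmorphM -mpolyXD; apply: pi_nonstd.
by apply: contra nm => /lex_std_quotient.
Qed.

Lemma lex_not_injective a d :
  (low d.+1 (H d.+1) < H d)%N -> ~ mul_injective lex_ideal (linear_form a) d.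
Proof.
move=> lt_low inj; set l := low _ _ in lt_low.
have lt_l : (l < size (lexmons n n.+1 d))%N.
  exact: leq_trans lt_low (leq_size_lexmons d).
pose m := nth 0%MM (lexmons n n.+1 d) l.
have mN : m \in lex_basis d.
  by rewrite -[m](nth_take _ lt_low) mem_nth // size_lex_basis.
have nm : m \notin take l (lexmons n n.+1 d).
  by rewrite in_take ?mem_nth // index_uniq ?ltnn // uniq_lexmons.
move: (mN); rewrite mem_lex_basis => /andP[dm sm].
apply/negP: (pi_std_neq0 k lex_std0 lex_stdM sm); rewrite negbK; apply/eqP.
apply: inj.
- by exists 'X_[m] => //; rewrite dhomogX.
- by exists 0; rewrite ?rmorph0 ?dhomog0.
by rewrite mulr0 (lex_socle a mN nm).
Qed.

(** By [lex_socle] the image of degree [d] is spanned by the products with the first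
    [low d.+1 (H d.+1)] basis monomials, too few to span degree [d + 1]. *)
Lemma lex_not_surjective a d :
  (low d.+1 (H d.+1) <= H d)%N -> (low d.+1 (H d.+1) < H d.+1)%N ->
  ~ mul_surjective lex_ideal (linear_form a) d.
Proof.
move=> le_low; set l := low _ _ in le_low *; rewrite ltnNge => /negP nle surj; apply: nle.
pose s := take l (lexmons n n.+1 d).
have sz_s : size s = l.
  by rewrite size_takel // (leq_trans le_low) // leq_size_lexmons.
rewrite -sz_s.
apply: (has_dim_leq
  (w := fun q => \pi_A (linear_form a) * \pi_A 'X_[tnth (in_tuple s) q])
  (hilbert_lex_ideal d.+1)).
move=> v /surj[u [p hp ->] <-].
have -> : \pi_A p = \sum_(m <- lex_basis d) p@_m *: \pi_A 'X_[m].
  apply: monomial_span (uniq_lex_basis d) _ => m mp sm.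
  by rewrite mem_lex_basis sm andbT; apply/eqP/(dhomog_mf hp).
have take_s : take l (lex_basis d) = s by rewrite /lex_basis take_takel.
have drop0 m : m \in drop l (lex_basis d) ->
    \pi_A (linear_form a) * \pi_A 'X_[m] = 0.
  move=> md; rewrite (lex_socle a (mem_drop md)) //; apply/negP => ms.
  have := uniq_lex_basis d; rewrite -(cat_take_drop l (lex_basis d)) take_s.
  by rewrite cat_uniq => /and3P[_ /hasPn/(_ m md) /negP].
exists (fun q => p@_(tnth (in_tuple s) q)).
rewrite -(cat_take_drop l (lex_basis d)) take_s big_cat mulrDr /=.
rewrite addrC mulr_sumr big_seq big1 ?add0r; last first.
  by move=> m md; rewrite -quot_scaleAr drop0 ?scaler0.
rewrite mulr_sumr [LHS]big_tnth.
by apply: eq_bigr => q _; rewrite quot_scaleAr.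
Qed.

Lemma lex_not_WLP d : (low d.+1 (H d.+1) < H d)%N -> (d.+1 < H d.+1)%N ->
  ~ WLP lex_ideal.
Proof.
move=> lt_low lt_H [U [_ [a Ua] /(_ a Ua d)[|]]]; first exact: lex_not_injective.
by apply: lex_not_surjective; rewrite ?(ltnW lt_low) ?low_lt.
Qed.

End LexAlgebra.

(** * Macaulay's bound, propagation of surjectivity and the equivalence *)

Lemma macaulay_bound (k : fieldType) r (I : idealr {mpoly k[r]}) H d :
  [pchar k] =i pred0 -> hilbert_function I H -> (low d.+1 (H d.+1) <= H d)%N.
Proof.
move=> char0 /multiplication_system [X [gradX _ _]].
have [a /leq_trans] := generic_ex (generic_low d char0 gradX); apply.
exact: rank_leq_row.
Qed.

(** With [L] the form of [a], [x_j A_(d+1) = x_j L A_d = L x_j A_d] lies in [L A_(d+1)], and these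
    spaces span degree [d + 2]. *)
Lemma row_full_succ (k : fieldType) r (N : nat -> nat)
    (X : forall d, 'I_r -> 'M[k]_(N d, N d.+1)) d a :
  graded_multiplication X ->
  row_full (pencil (X d) a) -> row_full (pencil (X d.+1) a).
Proof.
move=> [Xcomm Xgen] full; apply: Xgen => j.
have sX : (1%:M *m X d.+1 j <= pencil (X d) a *m X d.+1 j)%MS.
  by apply: submxMr; apply: submx_full.
rewrite mul1mx in sX; apply: submx_trans sX _.
by rewrite -(pencil_delta (X d.+1) j) pencil_comm // submxMl.
Qed.

Local Close Scope ring_scope.

Theorem theorem5 (k : fieldType) (char0 : [pchar k]%R =i pred0)
    (H : nat -> nat) (e t : nat)
    (H0 : H 0 = 1) (He : forall i, e < i -> H i = 0)
    (Hocc : exists (r : nat) (I : idealr {mpoly k[r]}),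
        standard_graded_artinian I /\ hilbert_function I H)
    (Ht : H t <= t) (Htmin : forall s, H s <= s -> t <= s) :
  (forall (r : nat) (I : idealr {mpoly k[r]}),
      standard_graded_artinian I -> hilbert_function I H -> WLP I)
  <->
  (forall i, 1 <= i <= t - 1 -> binomial_lowering (H i) i (H i.-1)).
Proof.
have H_gt i : i < t -> i < H i.
  by move=> lt_it; rewrite ltnNge; apply/negP => /Htmin; lia.
have lowering i : 1 <= i <= t - 1 ->
    binomial_lowering (H i) i (H i.-1) <-> H i.-1 = low i (H i).
  by move=> hi; have := H_gt i; move=> hH; apply: binomial_loweringP; lia.
have t_gt0 : 0 < t by case: t Ht {Htmin H_gt lowering} => //; rewrite H0.
split=> [allWLP i hi|low_H r I _ hilbI].
  have [r0 [I0 [_ hilb0]]] := Hocc.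
  have macaulay d := macaulay_bound d char0 hilb0.
  apply/lowering => //.
  have [n H1] : exists n, H 1 = n.+1 by exists (H 1).-1; have := H_gt 1; lia.
  case: i hi => [|d] hi; first by lia.
  apply/eqP; rewrite eqn_leq macaulay andbT leqNgt; apply/negP => lt_low.
  have lt_H : d.+1 < H d.+1 by apply: H_gt; lia.
  case: (lex_not_WLP (k := k) (H0 := H0) (H1 := H1) (macaulay := macaulay)
    lt_low lt_H).
  by apply: allWLP; [exact: artinian_lex_ideal He _ | exact: hilbert_lex_ideal].
have [X [gradX freeP fullP]] := multiplication_system hilbI.
(* Finitely many rank conditions suffice, since surjectivity propagates from degree [t - 1] on. *)
have [f f_nz fP] : generic (fun a => forall i, i < t ->
    low i.+1 (H i.+1) <= \rank (pencil (X i) a)).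
  by apply: generic_all => // i _; apply: generic_low.
exists (fun a => f.@[a] <> 0)%R; split.
- exists (fun g => g = f) => a; split=> [fa0 h|h fa0]; first exact: fa0 (h f erefl).
  by apply: h => g ->.
- by have [a /eqP fa] := f_nz; exists a.
move=> a /eqP/fP rk i; case: (ltnP i.+1 t) => [lt_it|le_ti]; [left|right].
  apply: freeP; rewrite /row_free eqn_leq rank_leq_row /=.
  have hi : 1 <= i.+1 <= t - 1 by lia.
  have /= low_Hi := (lowering _ hi).1 (low_H _ hi).
  by have := rk i; rewrite -low_Hi; apply; lia.
apply: fullP; case: t Ht le_ti rk {Htmin H_gt lowering t_gt0 low_H fP} => [|s] Ht le_si rk.
  by rewrite H0 in Ht.
have -> : i = s + (i - s) by lia.
elim: (i - s) => [|j IH]; last by rewrite addnS; apply: row_full_succ.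
(* Here [t = s + 1], and [H t <= t] makes the lowering equal to [H t], so the map from degree [s] to
   degree [t] has full rank. *)
have := rk s (leqnn _); rewrite low_small // addn0 => rk_s.
by rewrite /row_full eqn_leq rank_leq_col.
Qed.
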